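(* Let $p$ be a prime and $F\colon\mathbb F_p^n\to\mathbb F_p^m$ a function. If $$\mathcal N_F<\frac{p^{2(n-m)}}{1-\frac1{p^m}},$$ then $F$ is surjective.
   Context: Standard scalar product $\langle x,y\rangle=\sum_ix_iy_i$, $\zeta_p=e^{2\pi i/p}$, $W_F(b,a)=\sum_{x\in\mathbb F_p^n}\zeta_p^{\langle b,F(x)\rangle-\langle a,x\rangle}$, and the imbalance $\mathcal N_F=\frac1{p^m}\sum_{b\in\mathbb F_p^m\setminus\{0\}}|W_F(b,0)|^2$. *)

(* Defs.v *)
From HB Require Import structures.
From mathcomp Require Import all_boot all_order all_algebra.
From mathcomp Require Import complex.
From mathcomp Require Import reals trigo.

Set Implicit Arguments.
Unset Strict Implicit.
Unset Printing Implicit Defensive.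

Import Order.TTheory GRing.Theory Num.Theory.
Local Open Scope ring_scope.
Local Open Scope complex_scope.

Definition dot (K : pzSemiRingType) (n : nat) (x y : 'rV[K]_n) : K :=
  \sum_(i < n) x 0 i * y 0 i.

(* e^{2 pi i / p}, written with Euler's formula *)
Definition zeta (R : realType) (p : nat) : R[i] :=
  cos (2 * pi / p%:R) +i* sin (2 * pi / p%:R).

(* The exponent is computed in 'F_p and read as its representative in
   {0, ..., p-1}; any other representative gives the same power of zeta. *)
Definition walsh (R : realType) (p n m : nat)
    (F : 'rV['F_p]_n -> 'rV['F_p]_m) (b : 'rV['F_p]_m) (a : 'rV['F_p]_n) :
    R[i] :=
  \sum_(x : 'rV['F_p]_n) zeta R p ^+ nat_of_ord (dot b (F x) - dot a x).

Definition imbalance (R : realType) (p n m : nat)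
    (F : 'rV['F_p]_n -> 'rV['F_p]_m) : R :=
  (p%:R ^+ m)^-1 *
  \sum_(b : 'rV['F_p]_m | b != 0) ComplexField.Normc.normc (walsh R F b 0) ^+ 2.

(* Main.v *)
(** If [y] is not a value of [F], orthogonality of the characters of [F_p^m]
    gives [\sum_b zeta^(-<b,y>) W_F(b,0) = p^m #|F^-1(y)| = 0].  The term [b = 0]
    is [p^n], so [p^n <= \sum_(b != 0) |W_F(b,0)|], and Cauchy-Schwarz over the
    [p^m - 1] nonzero [b] yields [p^(2n) <= (p^m - 1) p^m N_F]. *)
Require Import Defs.
From mathcomp Require Import all_boot all_order all_algebra.
From mathcomp Require Import complex.
From mathcomp Require Import reals trigo.
From mathcomp Require Import ring.

Import Order.TTheory GRing.Theory Num.Theory.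
Import ComplexField.Normc.
Local Open Scope ring_scope.

(** Cauchy-Schwarz against the constant family 1. With [N] terms, sum [s] and sum of squares [q],
    the nonnegative sum of the [(N * a i - s) ^+ 2] equals [N * (N * q - s ^+ 2)]; scaling by [N]
    avoids dividing by it to form the mean. *)
Lemma sqr_sum_le (R : realDomainType) (I : finType) (P : pred I) (a : I -> R) :
  (\sum_(i | P i) a i) ^+ 2 <= #|P|%:R * \sum_(i | P i) a i ^+ 2.
Proof.
set s := \sum_(i | P i) a i; set q := \sum_(i | P i) _; set N := #|P|%:R : R.
have: 0 <= \sum_(i | P i) (N * a i - s) ^+ 2.
  by apply: sumr_ge0 => i _; exact: sqr_ge0.
rewrite (eq_bigr (fun i => N ^+ 2 * a i ^+ 2 - (2 * N * s) * a i + s ^+ 2)); last first.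
  by move=> i _; ring.
rewrite big_split sumrB -!mulr_sumr /= -/s -/q sumr_const -[_ *+ #|P|]mulr_natl -/N.
rewrite [X in 0 <= X](_ : _ = N * (N * q - s ^+ 2)); last by ring.
(* The factor [N] can be cancelled only when it is positive; for empty [P] both sides vanish. *)
have [card0 _|card_gt0] := posnP #|P|.
  by rewrite /s /q !big_pred0 ?mulr0 ?expr0n //= => i; exact: (card0_eq card0 i).
by rewrite pmulr_rge0 ?ltr0n // subr_ge0.
Qed.

Section Dot.
Variables (K : pzRingType) (n : nat).
Implicit Types x y z : 'rV[K]_n.

Lemma dot0l x : dot 0 x = 0.
Proof. by apply: big1 => i _; rewrite mxE mul0r. Qed.

Lemma dotDl x y z : dot (x + y) z = dot x z + dot y z.
Proof. by rewrite -big_split; apply: eq_bigr => i _; rewrite mxE mulrDl. Qed.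

Lemma dotBr x y z : dot x (y - z) = dot x y - dot x z.
Proof. by rewrite -sumrB; apply: eq_bigr => i _; rewrite !mxE mulrBr. Qed.

End Dot.

Lemma dot_eq1 (K : fieldType) n (v : 'rV[K]_n) :
  v != 0 -> exists c : 'rV[K]_n, dot c v = 1.
Proof.
case/rV0Pn => i vi0; exists ((v 0 i)^-1 *: delta_mx 0 i).
rewrite /dot (bigD1 i) //= big1 ?addr0 => [|j ji]; rewrite !mxE ?eqxx.
  by rewrite mulr1 mulVf.
by rewrite (negbTE ji) mulr0 mul0r.
Qed.

Section Character.
Variables (R : realType) (p : nat) (p_prime : prime p).

(** De Moivre's formula, by induction from the addition formulas. *)
Lemma cos_sin_exp (t : R) k :
  (cos t +i* sin t)%C ^+ k = (cos (t *+ k) +i* sin (t *+ k))%C.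
Proof.
elim: k => [|k IHk]; first by rewrite expr0 mulr0n cos0 sin0.
rewrite exprS IHk mulrS cosD sinD; apply/eqP; rewrite eq_complex /=.
by rewrite eqxx addrC [cos t * _]mulrC eqxx.
Qed.

Lemma zeta_exp_p : zeta R p ^+ p = 1.
Proof.
have p0 : p%:R != 0 :> R by rewrite pnatr_eq0 -lt0n prime_gt0.
by rewrite cos_sin_exp -[_ *+ p]mulr_natr divfK // mulr_natl cos2pi sin2pi.
Qed.

Lemma normc_zeta : normc (zeta R p) = 1.
Proof. by rewrite /= cos2Dsin2 sqrtr1. Qed.

Lemma zeta_neq1 : zeta R p != 1.
Proof.
have p_gt1 := prime_gt1 p_prime.
have p_gt0 : 0 < p%:R :> R by rewrite ltr0n ltnW.
have t_gt0 : 0 < 2 * pi / p%:R :> R.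
  by rewrite divr_gt0 // mulr_gt0 // pi_gt0.
rewrite eq_complex negb_and; apply/orP; left; apply/eqP => /= cos1.
suff t0 : 2 * pi / p%:R = 0 :> R by rewrite t0 ltxx in t_gt0.
(* Cosine is injective on [[0, pi]], and [2 * pi / p] lies there because [p >= 2]. *)
apply: cos_inj; rewrite ?cos0 ?in_itv //= ?lexx ?pi_ge0 //.
rewrite (ltW t_gt0) ler_pdivrMr // mulrC ler_wpM2l ?pi_ge0 //.
by rewrite ler_nat.
Qed.

Definition chi (u : 'F_p) : R[i] := zeta R p ^+ nat_of_ord u.

Lemma chi0 : chi 0 = 1. Proof. by []. Qed.

(** Addition in ['F_p] reduces representatives modulo [p], which is harmless since
    [zeta R p ^+ p = 1]. *)
Lemma chiD u v : chi (u + v) = chi u * chi v.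
Proof. by rewrite /chi -exprD /= [X in (_ %% X)%N]Fp_cast // expr_mod ?zeta_exp_p. Qed.

Lemma normc_chi u : normc (chi u) = 1.
Proof.
rewrite /chi; elim: (nat_of_ord u) => [|k IHk].
  by rewrite expr0 normc1.
by rewrite exprS normcM IHk mulr1 normc_zeta.
Qed.

(** Translating [b] by some [c] with [dot c v = 1] permutes the terms but multiplies the sum by
    [zeta R p], which differs from 1; so the sum is zero. *)
Lemma sum_chi_dot m (v : 'rV['F_p]_m) : v != 0 -> \sum_b chi (dot b v) = 0.
Proof.
case/dot_eq1 => c cv1; set S := LHS.
have chi1 : chi 1 = zeta R p by rewrite /chi /= expr1.
have SE : S = zeta R p * S.
  rewrite {1}/S (reindex_inj (addrI c)) /= mulr_sumr; apply: eq_bigr => b _.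
  by rewrite dotDl cv1 chiD chi1.
apply/eqP; have /eqP : (zeta R p - 1) * S = 0.
  by rewrite mulrBl -SE mul1r subrr.
by rewrite mulf_eq0 subr_eq0 (negbTE zeta_neq1).
Qed.

Lemma card_rV_Fp k : #|{: 'rV['F_p]_k}| = (p ^ k)%N.
Proof. by rewrite card_mx card_Fp // mul1n. Qed.

Variables (n m : nat) (F : 'rV['F_p]_n -> 'rV['F_p]_m).

Lemma walsh_0r b : walsh R F b 0 = \sum_x chi (dot b (F x)).
Proof. by apply: eq_bigr => x _; rewrite dot0l subr0. Qed.

Lemma walsh_00 : walsh R F 0 0 = p%:R ^+ n.
Proof.
rewrite walsh_0r (eq_bigr (fun=> 1)) => [|x _]; last by rewrite dot0l.
by rewrite sumr_const card_rV_Fp natrX.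
Qed.

(** After exchanging sums, each [x] contributes the full character sum at the nonzero vector
    [F x - y]. *)
Lemma sum_chi_walsh y : (forall x, F x != y) ->
  \sum_b chi (- dot b y) * walsh R F b 0 = 0.
Proof.
move=> Fy; under eq_bigr do rewrite walsh_0r mulr_sumr.
rewrite exchange_big big1 //= => x _.
rewrite -[RHS](@sum_chi_dot m (F x - y)) ?subr_eq0 //.
by apply: eq_bigr => b _; rewrite -chiD addrC dotBr.
Qed.

Lemma normc_ge0 (z : R[i]) : 0 <= normc z.
Proof. by case: z => u v; exact: sqrtr_ge0. Qed.

Lemma normc_sum_le (I : Type) (r : seq I) (P : pred I) (f : I -> R[i]) :
  normc (\sum_(i <- r | P i) f i) <= \sum_(i <- r | P i) normc (f i).
Proof.
elim/big_ind2: _ => [|x1 x2 y1 y2 le1 le2|//]; first by rewrite normc0.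
by apply: le_trans (le_normcD _ _) (lerD le1 le2).
Qed.

Lemma sum_normc_walsh_ge y : (forall x, F x != y) ->
  p%:R ^+ n <= \sum_(b | b != 0) normc (walsh R F b 0).
Proof.
move=> /sum_chi_walsh; rewrite (bigD1 0) //= dot0l oppr0 chi0 mul1r walsh_00.
(* The term [b = 0], equal to [p ^ n], is minus the sum of the others; the characters in those have
   modulus 1. *)
move/eqP; rewrite addr_eq0 => /eqP pnE.
have -> : p%:R ^+ n = normc (p%:R ^+ n : R[i]) :> R.
  by rewrite -!natrX normcMn normc1.
rewrite pnE normcN; apply: le_trans (normc_sum_le _ _ _ _) _.
by apply: ler_sum => b _; rewrite normcM normc_chi mul1r.
Qed.

Lemma imbalance_ge y : (forall x, F x != y) ->
  (p%:R ^+ n) ^+ 2 <= (p%:R ^+ m - 1) * (p%:R ^+ m * imbalance R F).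
Proof.
move=> Fy; have pm0 : p%:R ^+ m != 0 :> R.
  by rewrite expf_neq0 // pnatr_eq0 -lt0n prime_gt0.
rewrite /imbalance mulVKf //.
have cardE : p%:R ^+ m - 1 = #|[pred b : 'rV['F_p]_m | b != 0]|%:R :> R.
  by rewrite cardC1 card_rV_Fp -subn1 natrB ?natrX // expn_gt0 prime_gt0.
rewrite cardE; apply: le_trans (sqr_sum_le _ _ _ _).
rewrite ler_pXn2r ?nnegrE ?exprn_ge0 ?(sum_normc_walsh_ge _ Fy) //.
by apply: sumr_ge0 => b _; exact: normc_ge0.
Qed.

End Character.

Theorem theorem4p4 (R : realType) (p n m : nat) (p_prime : prime p)
    (F : 'rV['F_p]_n -> 'rV['F_p]_m)
    (F_imbalance : imbalance R F
       < (p%:R : R) ^ (2 * (n%:Z - m%:Z)) / (1 - (p%:R ^+ m)^-1)) :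
  forall y : 'rV['F_p]_m, exists x : 'rV['F_p]_n, F x = y.
Proof.
move=> y; have [/existsP[x /eqP]|] := boolP [exists x, F x == y]; first by exists x.
rewrite negb_exists => /forallP Fy; exfalso.
have := imbalance_ge R _ p_prime _ _ F y Fy.
have p_neq0 : p%:R != 0 :> R by rewrite pnatr_eq0 -lt0n prime_gt0.
(* For [m = 0] the codomain is a single point, so [F 0 = y] already contradicts [Fy]. For [m > 0]
   the denominator [1 - q^-1] is positive. *)
case: m F y Fy F_imbalance => [F0 y0 /(_ 0)|k F1 y1 _ F1_lt].
  by rewrite [F0 0]thinmx0 [y0]thinmx0 eqxx.
set q := p%:R ^+ k.+1 in F1_lt *.
have q_gt1 : 1 < q by rewrite exprn_egt1 // ltr1n prime_gt1.
have q_gt0 : 0 < q by apply: lt_trans q_gt1.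
(* The exponent is an integer since [n - m] may be negative. Writing the power as [(p ^ n / q) ^ 2]
   gives the bound the shape of [imbalance_ge]. *)
have rhsE : (p%:R : R) ^ (2 * (n%:Z - k.+1%:Z)) / (1 - q^-1)
    = (p%:R ^+ n) ^+ 2 / ((q - 1) * q).
  rewrite [2 * _]mulrC -exprz_exp [in LHS](expfzDr n _ p_neq0) -invr_expz.
  rewrite -[LHS]/((p%:R ^+ n / q) ^+ 2 / (1 - q^-1)); field.
  by rewrite subr_eq0 (gt_eqF q_gt0) (gt_eqF q_gt1).
rewrite rhsE ltr_pdivlMr ?mulr_gt0 ?subr_gt0 // mulrC -mulrA in F1_lt.
by rewrite leNgt F1_lt.
Qed.
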